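(* Let $M$, $C$, $W$, $P$, $Q$ and the sequences $\mathbf{x}^{\langle k\rangle}$, $\mathbf{y}^{\langle k\rangle}$ be as in the context. Then the sequences $(\mathbf{x}^{\langle k\rangle})_{k\ge 0}$ and $(\mathbf{y}^{\langle k\rangle})_{k\ge 0}$ converge, as $k\to\infty$, to limits $\mathbf{x}^\star\in\mathbb{R}^m$ and $\mathbf{y}^\star\in\mathbb{R}^n$ respectively. Moreover, $\mathbf{x}^\star$ is a principal eigenvector of $P = W(I+C^T)M^T$, and $\mathbf{y}^\star$ is a principal eigenvector of $Q=(I+C^T)M^TW$. Further, both $\mathbf{x}^\star$ and $\mathbf{y}^\star$ have all components non-negative and are non-zero (their components sum to $1$).
   Context: There are $m$ authors $a_1,\dots,a_m$ and $n$ papers $p_1,\dots,p_n$. The publication matrix $M=(m_{ij})$ is the $m\times n$ $0$-$1$ matrix with $m_{ij}=1$ iff author $a_i$ wrote paper $p_j$; every paper has at least one author, i.e. $\sum_{i=1}^m m_{ij}\ge 1$ for every $j$. The citation matrix $C=(c_{jk})$ is the $n\times n$ $0$-$1$ matrix with $c_{jk}=1$ iff paper $p_j$ cites paper $p_k$; the directed citation graph (edge $p_j\to p_k$ iff $c_{jk}=1$) has no directed cycles. The weight matrix $W=(w_{ij})$ is the $m\times n$ matrix with $w_{ij}=m_{ij}/\sum_{l=1}^m m_{lj}$. $I$ denotes the $n\times n$ identity matrix. Set $P=W(I+C^T)M^T$ (an $m\times m$ non-negative matrix) and $Q=(I+C^T)M^TW$ (an $n\times n$ non-negative matrix). Let $\mathbf{x}^{\langle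 0\rangle}=\mathbf{1}\in\mathbb{R}^m$ and $\mathbf{y}^{\langle 0\rangle}=\mathbf{1}\in\mathbb{R}^n$ be all-ones vectors, and for $k\ge 0$ let the (normalized) author and paper score vectors be $\mathbf{x}^{\langle k\rangle}=P^k\mathbf{x}^{\langle 0\rangle}/\|P^k\mathbf{x}^{\langle 0\rangle}\|_1$ and $\mathbf{y}^{\langle k\rangle}=Q^k\mathbf{y}^{\langle 0\rangle}/\|Q^k\mathbf{y}^{\langle 0\rangle}\|_1$, so that each vector has non-negative entries summing to $1$ (this corresponds to iterating the update rules $\mathbf{x}\leftarrow W\mathbf{y}$, $\mathbf{y}\leftarrow M^T\mathbf{x}$, $\mathbf{y}\leftarrow (I+C^T)\mathbf{y}$ and normalizing each iterate to sum $1$). A principal eigenvector of a square non-negative matrix $A$ is an eigenvector of $A$ associated with an eigenvalue of maximal modulus (the spectral radius of $A$). *)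

(* Defs.v *)
From Stdlib Require Import Reals Lra Lia Arith.
Open Scope R_scope.

Fixpoint sumR (d : nat) (f : nat -> R) : R :=
  match d with
  | O => 0
  | S d' => sumR d' f + f d'
  end.

(* Vectors are nat -> R (only indices < dimension matter);
   matrices are nat -> nat -> R (entry (i,j)). *)
Definition b2R (b : bool) : R := if b then 1 else 0.

Definition matmul (d : nat) (A B : nat -> nat -> R) : nat -> nat -> R :=
  fun i k => sumR d (fun j => A i j * B j k).

Definition matvec (d : nat) (A : nat -> nat -> R) (v : nat -> R) : nat -> R :=
  fun i => sumR d (fun j => A i j * v j).

Fixpoint matpowvec (d : nat) (A : nat -> nat -> R) (k : nat) (v : nat -> R) : nat -> R :=
  match k with
  | O => v
  | S k' => matvec d A (matpowvec d A k' v)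
  end.

Definition ones : nat -> R := fun _ => 1.

Definition normalize1 (d : nat) (v : nat -> R) : nat -> R :=
  fun i => v i / sumR d (fun j => Rabs (v j)).

Definition Mmat (Mb : nat -> nat -> bool) : nat -> nat -> R :=
  fun i j => b2R (Mb i j).
Definition MTmat (Mb : nat -> nat -> bool) : nat -> nat -> R :=
  fun j i => b2R (Mb i j).
Definition Wmat (m : nat) (Mb : nat -> nat -> bool) : nat -> nat -> R :=
  fun i j => b2R (Mb i j) / sumR m (fun l => b2R (Mb l j)).
Definition ICTmat (Cb : nat -> nat -> bool) : nat -> nat -> R :=
  fun j k => (if Nat.eqb j k then 1 else 0) + b2R (Cb k j).

Definition Pmat (m n : nat) (Mb Cb : nat -> nat -> bool) : nat -> nat -> R :=
  matmul n (matmul n (Wmat m Mb) (ICTmat Cb)) (MTmat Mb).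
Definition Qmat (m n : nat) (Mb Cb : nat -> nat -> bool) : nat -> nat -> R :=
  matmul m (matmul n (ICTmat Cb) (MTmat Mb)) (Wmat m Mb).

(* Directed citation graph on papers 0..n-1 has no directed cycle
   (a self-loop c_jj = 1 counts as a cycle of length 1). *)
Definition acyclic (n : nat) (Cb : nat -> nat -> bool) : Prop :=
  forall (L : nat) (p : nat -> nat),
    (0 < L)%nat ->
    (forall t, (t <= L)%nat -> (p t < n)%nat) ->
    (forall t, (t < L)%nat -> Cb (p t) (p (S t)) = true) ->
    p L <> p 0%nat.

(* a + i b is a (complex) eigenvalue of the real d x d matrix A:
   there is a nonzero complex vector u + i v with A(u+iv) = (a+ib)(u+iv). *)
Definition is_eigenvalueC (d : nat) (A : nat -> nat -> R) (a b : R) : Prop :=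
  exists u v : nat -> R,
    (exists i, (i < d)%nat /\ (u i <> 0 \/ v i <> 0)) /\
    (forall i, (i < d)%nat ->
       matvec d A u i = a * u i - b * v i /\
       matvec d A v i = b * u i + a * v i).

(* x is a principal eigenvector of A: an eigenvector of A whose eigenvalue
   has maximal modulus among all (complex) eigenvalues of A.
   (A real nonzero eigenvector of a real matrix has a real eigenvalue.) *)
Definition principal_eigenvector (d : nat) (A : nat -> nat -> R) (x : nat -> R) : Prop :=
  exists lam : R,
    (exists i, (i < d)%nat /\ x i <> 0) /\
    (forall i, (i < d)%nat -> matvec d A x i = lam * x i) /\
    (forall a b, is_eigenvalueC d A a b -> sqrt (a * a + b * b) <= Rabs lam).

Definition xseq (m n : nat) (Mb Cb : nat -> nat -> bool) (k : nat) : nat -> R :=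
  normalize1 m (matpowvec m (Pmat m n Mb Cb) k ones).
Definition yseq (m n : nat) (Mb Cb : nat -> nat -> bool) (k : nat) : nat -> R :=
  normalize1 n (matpowvec n (Qmat m n Mb Cb) k ones).

(* Main.v *)
(** [P] and [Q] are nonnegative matrices whose rows either vanish or have a
    diagonal entry at least [d := 1 / m].  For such a matrix [A], let [x] be an
    eigenvalue of maximal modulus [p], with eigenvector [v].  Taking moduli in
    [(A - d) v = (x - d) v] gives [A |v| >= (d + |x - d|) |v|], hence
    [d + |x - d| <= p = |x|], because an inequality [A u >= t u] with [u >= 0]
    nonzero forces an eigenvalue of modulus at least [t].  Therefore [x = p]:
    [p] is the only eigenvalue of maximal modulus.  Split the all-ones vector
    as [vK + vR] along the generalised eigenspace of [p] and its invariant
    complement.  Then [A^k vR = O(r^k)] with [r < p], while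
    [A^k vK = p^k \sum_(j <= D) 'C(k, j) f_j], where the last term [f_D] of the
    Jordan chain is an eigenvector for [p].  Hence
    [A^k 1 / (p^k 'C(k, D))] tends to [f_D], and normalising gives the limit. *)

Require Import Defs.
From Stdlib Require Import Reals Lra Lia Classical.
From mathcomp Require all_boot all_order all_algebra.
From mathcomp Require reals complex Rstruct ring lra.
Open Scope R_scope.

Module Spectral.
Import all_boot all_order all_algebra reals complex ring lra.
Import Order.TTheory GRing.Theory Num.Theory Normc.
Local Open Scope ring_scope.
Set Implicit Arguments.
Unset Strict Implicit.
Unset Printing Implicit Defensive.

Section Spectral.
Variable R : realType.
Local Notation C := (R[i]).
Local Notation toC := (real_complex R).

(** * Complex moduli, and decay of matrix powers on a kernel *)

Lemma normc_ge0 (x : C) : 0 <= normc x.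
Proof. by case: x => a b; exact: sqrtr_ge0. Qed.

Lemma normcD (x y : C) : normc (x + y) <= normc x + normc y.
Proof. exact: le_normcD. Qed.

Lemma normc_real (x : R) : normc (toC x) = `|x|.
Proof. by rewrite /= expr0n addr0 sqrtr_sqr. Qed.

Lemma normc_sum (I : Type) (s : seq I) (F : I -> C) :
  normc (\sum_(i <- s) F i) <= \sum_(i <- s) normc (F i).
Proof.
apply: (big_ind2 (fun x y => normc x <= y)) => //; first by rewrite normc0.
by move=> x1 x2 y1 y2 h1 h2; apply: (le_trans (normcD _ _)); rewrite lerD.
Qed.

(** Peeling off one root [x] leaves [w' = (A - x) w], which the remaining factors kill. The
    recursion [A^(k+1) w = x A^k w + A^k w'] carries the bound from [w'] to [w], so repeated roots
    and non-diagonalisable matrices need no special care. *)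
Lemma horner_ker_bound (n : nat) (A : 'M[C]_n.+1) (r : R) (s : seq C)
    (w : 'cV[C]_n.+1) :
  0 < r -> (forall x, x \in s -> normc x < r) ->
  horner_mx A (\prod_(x <- s) ('X - x%:P)) *m w = 0 ->
  exists2 K, 0 <= K &
    forall k i, normc ((A ^+ k *m w) i 0) <= K * r ^+ k.
Proof.
move=> r0; elim: s w => [|x s IHs] w sr.
  rewrite big_nil rmorph1 mul1mx => ->; exists 0 => // k i.
  by rewrite mulmx0 mxE normc0 mul0r.
rewrite big_cons mulrC rmorphM /= -mulmxE -mulmxA => hw.
have xr : normc x < r by apply: sr; rewrite mem_head.
have [K K0 hK] := IHs _ (fun y ys => sr y (mem_behead (s := x :: s) ys)) hw.
set w' := horner_mx A ('X - x%:P) *m w in hw hK.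
have Aw : A *m w = x *: w + w'.
  rewrite /w' rmorphB /= horner_mx_X horner_mx_C mulmxBl mul_scalar_mx.
  by rewrite addrC subrK.
pose M0 := \sum_i normc (w i 0).
have M00 : 0 <= M0 by apply: sumr_ge0 => i _; exact: normc_ge0.
have rx : 0 < r - normc x by rewrite subr_gt0.
have Kx : 0 <= K / (r - normc x) by rewrite divr_ge0 // ltW.
(* [M0] covers [k = 0]; the second summand makes [|x| K' + K <= r K'], which closes the
   induction. *)
exists (M0 + K / (r - normc x)); first by rewrite addr_ge0.
elim=> [|k IHk] i.
  rewrite expr0 mul1mx mulr1 (le_trans _ (_ : M0 <= _)) ?lerDl//.
  rewrite /M0 (bigD1 i) //= lerDl.
  by apply: sumr_ge0 => j _; exact: normc_ge0.
rewrite exprSr -mulmxE -mulmxA Aw mulmxDr -scalemxAr !mxE.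
have := normcD (x * (A ^+ k *m w) i 0) ((A ^+ k *m w') i 0).
rewrite normcM; rewrite !mxE => /le_trans; apply.
have := hK k i; have := IHk i; rewrite !mxE => h1 h2.
have h3 := ler_wpM2l (normc_ge0 x) h1.
apply: (le_trans (lerD h3 h2)); rewrite mulrA -mulrDl exprS mulrA.
apply: ler_wpM2r; first by rewrite exprn_ge0 // ltW.
set K' := M0 + _.
have : K <= K' * (r - normc x).
  by rewrite mulrDl divfK ?gt_eqF // lerDr mulr_ge0 // ltW.
lra.
Qed.

(** * Growth rates, extremal moduli and binomial ratios *)

Lemma bernoulli (x : R) (k : nat) : 0 <= x -> 1 + x *+ k <= (1 + x) ^+ k.
Proof.
move=> x0; elim: k => [|k IHk]; first by rewrite expr0 addr0.
have h : 0 <= (1 + x) by rewrite addr_ge0.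
have := ler_wpM2l h IHk; rewrite -exprS; apply: le_trans.
have : 0 <= x * (x *+ k) by rewrite mulr_ge0 // mulrn_wge0.
rewrite mulrSr; lra.
Qed.

(** With [x = t / r - 1], Bernoulli gives [(t / r)^k >= 1 + k x], which exceeds [|K| / c] once
    [k > |K| / (c x)]. *)
Lemma expr_not_dominated (c K r t : R) : 0 < c -> 0 < r -> r < t ->
  ~ (forall k, c * t ^+ k <= K * r ^+ k).
Proof.
move=> c0 r0 rt h.
pose x := t / r - 1.
have x0 : 0 < x by rewrite subr_gt0 ltr_pdivlMr // mul1r.
pose k := Num.bound (`|K| / (c * x)).
have hk : `|K| / (c * x) < k%:R by apply: archi_boundP; rewrite divr_ge0 // mulr_ge0 // ltW.
have := h k; rewrite -ler_pdivrMr ?exprn_gt0 // -mulrA -expr_div_n.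
have -> : t / r = 1 + x by rewrite /x addrC subrK.
have := ler_wpM2l (ltW c0) (bernoulli k (ltW x0)) => h1 h2.
move: hk; rewrite ltr_pdivrMr ?mulr_gt0 // => h3.
have := ler_norm K => h4.
rewrite -mulr_natr in h1; nra.
Qed.

(** Finiteness of the list leaves room for one radius strictly below [t]; this radius serves as the
    geometric rate in [horner_ker_bound]. *)
Lemma moduli_gap (s : seq C) (t : R) : 0 < t ->
  (forall x, x \in s -> normc x < t) ->
  exists2 r, 0 < r < t & forall x, x \in s -> normc x < r.
Proof.
move=> t0; elim: s => [|x s IHs] hs; first by exists (t / 2); [lra|].
have [r /andP[r0 rt] hr] := IHs (fun y ys => hs y (mem_behead (s := x :: s) ys)).
have xt : normc x < t by apply: hs; rewrite mem_head.
exists (Num.max r ((normc x + t) / 2)).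
  by rewrite lt_max r0 gt_max rt /=; lra.
move=> y; rewrite in_cons lt_max => /orP[/eqP->|/hr ->//].
by apply/orP; right; lra.
Qed.

Lemma exists_max_modulus (s : seq C) x : x \in s ->
  exists2 y, y \in s & forall z, z \in s -> normc z <= normc y.
Proof.
elim: s x => // a [|b s] IHs x xs.
  by exists a; rewrite ?mem_head // => z; rewrite inE => /eqP ->.
have [y ys hy] := IHs b (mem_head _ _).
have [le|lt] := leP (normc a) (normc y).
  exists y => [|z]; first by rewrite in_cons ys orbT.
  by rewrite in_cons => /orP[/eqP->//|/hy].
exists a => [|z]; first by rewrite mem_head.
by rewrite in_cons => /orP[/eqP->//|/hy h]; apply: (le_trans h); apply: ltW.
Qed.

Lemma normc_eq0 (x : C) : (normc x == 0) = (x == 0).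
Proof. by apply/eqP/eqP => [/eq0_normc|->] //; rewrite normc0. Qed.

(** This makes the lower terms of a Jordan chain negligible, by a factor of order [1 / k]. It comes
    from [(l + 1) C(k, l+1) = (k - l) C(k, l)]; for [k >= 2 D] the same identity makes the binomials
    increase up to index [D]. *)
Lemma bin_ratio_le D k j : (D + D <= k)%N -> (j < D)%N ->
  ('C(k, j) * (k - D) <= D * 'C(k, D))%N.
Proof.
move=> Dk jD.
have step l : (l < D)%N -> ('C(k, l) * (k - D) <= D * 'C(k, l.+1))%N.
  move=> lD; apply: (@leq_trans ((k - l) * 'C(k, l))).
    by rewrite mulnC leq_mul // leq_sub2l // ltnW.
  by rewrite -mul_bin_left leq_mul.
have D0 : (0 < D)%N := leq_ltn_trans (leq0n j) jD.
have mono l : (l <= D)%N -> ('C(k, l) <= 'C(k, D))%N.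
  move=> lD; rewrite -(subKn lD); elim: (D - l)%N (leq_subr l D) => [|t IHt] tD.
    by rewrite subn0.
  apply: leq_trans (IHt (ltnW tD)); rewrite -(leq_pmul2r D0).
  rewrite [X in (_ <= X)%N]mulnC (leq_trans _ (_ : 'C(k, D - t.+1) * (k - D) <= _)%N) //.
    by rewrite leq_mul // leq_subRL ?(leq_trans (leq_addr D D) Dk).
  by rewrite -(subnSK tD); apply: step; rewrite ltn_subrL D0.
by apply: (leq_trans (step j jD)); rewrite leq_mul // mono.
Qed.

(** Writing [p / r = 1 + x], Bernoulli gives [k x <= (p / r)^k], so [1 / x] is a valid bound. *)
Lemma expr_ratio_bound (r p : R) : 0 < r < p ->
  exists2 K, 0 <= K & forall k, (r / p) ^+ k * k%:R <= K.
Proof.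
move=> /andP[r0 rp]; pose x := p / r - 1.
have x0 : 0 < x by rewrite subr_gt0 ltr_pdivlMr // mul1r.
have p0 := lt_trans r0 rp.
exists x^-1 => [|k]; first by rewrite invr_ge0 ltW.
rewrite -[x^-1]mul1r ler_pdivlMr // -mulrA.
have h := bernoulli k (ltW x0).
have e : (r / p) ^+ k * (1 + x) ^+ k = 1.
  rewrite -exprMn /x addrC subrK mulrA divfK ?gt_eqF // divff ?gt_eqF //.
  by rewrite expr1n.
have rk : 0 <= (r / p) ^+ k by rewrite exprn_ge0 // divr_ge0 // ltW.
rewrite -[X in _ <= X]e; apply: ler_wpM2l => //; apply: le_trans h.
by rewrite mulr_natl lerDr.
Qed.

(** * Nonnegative matrices: monotonicity and large eigenvalues *)

Section NonNegative.
Variables (n : nat) (A : 'M[R]_n.+1).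
Hypothesis A0 : forall i j, 0 <= A i j.

Lemma expmx_ge0 k i j : 0 <= (A ^+ k) i j.
Proof.
elim: k i j => [|k IHk] i j; first by rewrite expr0 !mxE; case: eqP.
by rewrite exprS -mulmxE mxE sumr_ge0 // => l _; rewrite mulr_ge0.
Qed.

Lemma expmx_le (u w : 'cV[R]_n.+1) k i :
  (forall i, u i 0 <= w i 0) -> (A ^+ k *m u) i 0 <= (A ^+ k *m w) i 0.
Proof.
by move=> uw; rewrite !mxE ler_sum // => j _; rewrite ler_wpM2l // expmx_ge0.
Qed.

Lemma expmx_supereigen (u : 'cV[R]_n.+1) t k i : 0 <= t ->
  (forall i, t * u i 0 <= (A *m u) i 0) -> t ^+ k * u i 0 <= (A ^+ k *m u) i 0.
Proof.
move=> t0 hu; elim: k i => [|k IHk] i; first by rewrite expr0 mul1mx mul1r.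
rewrite [A ^+ _]exprSr -mulmxE -mulmxA.
apply: (le_trans _ (expmx_le (u := t *: u) (w := A *m u) k i _)).
  by rewrite -scalemxAr mxE exprS -mulrA ler_wpM2l.
by move=> j; rewrite mxE.
Qed.

Local Notation AC := (map_mx toC A).

Lemma expmx_toC k (w : 'cV[R]_n.+1) i :
  (AC ^+ k *m map_mx toC w) i 0 = toC ((A ^+ k *m w) i 0).
Proof. by rewrite -rmorphXn -map_mxM mxE. Qed.

(** If all roots had modulus below [t], Cayley-Hamilton and [horner_ker_bound] would give
    [A^k u = O(r^k)] with [r < t], while monotonicity gives [A^k u >= t^k u], which is positive at
    coordinate [i]. *)
Lemma exists_large_root (s : seq C) (u : 'cV[R]_n.+1) t i :
  char_poly AC = \prod_(x <- s) ('X - x%:P) ->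
  (forall i, 0 <= u i 0) -> 0 < u i 0 -> 0 < t ->
  (forall i, t * u i 0 <= (A *m u) i 0) ->
  exists2 x, x \in s & t <= normc x.
Proof.
move=> Es u0 ui t0 hu; apply/hasP; apply/negPn/negP => /hasPn h.
have [r /andP[r0 rt] hr] : exists2 r, 0 < r < t & forall x, x \in s -> normc x < r.
  by apply: moduli_gap => // x /h; rewrite -ltNge.
have hker : horner_mx AC (\prod_(x <- s) ('X - x%:P)) *m map_mx toC u = 0.
  by rewrite -Es Cayley_Hamilton mul0mx.
have [K _ hK] := horner_ker_bound r0 hr hker.
apply: (@expr_not_dominated (u i 0) K r t) => // k.
have := hK k i; rewrite expmx_toC normc_real; apply: le_trans.
rewrite mulrC; apply: (le_trans (expmx_supereigen k i (ltW t0) hu)).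
exact: ler_norm.
Qed.

(** * Uniqueness of the eigenvalue of maximal modulus *)

Variable d : R.
Hypothesis d0 : 0 < d.
Hypothesis Ad : forall i, d <= A i i \/ forall j, A i j = 0.

(* Splitting [A = d + (A - d)] and taking moduli in [(A - d) v = (x - d) v]
   loses less than taking them in [A v = x v]. *)
Lemma eigenvector_modulus (x : C) (v : 'cV[C]_n.+1) i :
  x != 0 -> AC *m v = x *: v ->
  (d + normc (x - toC d)) * normc (v i 0) <=
    (A *m map_mx (@normc R) v) i 0.
Proof.
move=> x0 Av; rewrite !mxE.
under eq_bigr do rewrite mxE.
have Avi : \sum_j toC (A i j) * v j 0 = x * v i 0.
  move: (congr1 (fun M : 'cV_n.+1 => M i 0) Av); rewrite !mxE => <-.
  by apply: eq_bigr => j _; rewrite mxE.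
(* In a zero row, [x * v i = 0] with [x] nonzero forces [v i = 0], so the left side vanishes. *)
case: (Ad i) => [dA|rA]; last first.
  move: Avi; rewrite big1 => [/esym/eqP|j _]; last by rewrite rA mul0r.
  rewrite mulf_eq0 (negbTE x0) /= => /eqP ->.
  rewrite normc0 mulr0; apply: sumr_ge0 => j _.
  by rewrite mulr_ge0 // normc_ge0.
(* Row [i] of [A - d] stays nonnegative because [d <= A i i], so its entries equal their moduli. *)
have e : \sum_j toC (A i j - d *+ (j == i)) * v j 0 = (x - toC d) * v i 0.
  rewrite mulrBl -Avi (bigD1 i) //= [in RHS](bigD1 i) //= eqxx.
  under eq_bigr => j ji do rewrite (negbTE ji) subr0.
  by rewrite rmorphB mulrBl addrAC.
have := normc_sum (index_enum _) (fun j => toC (A i j - d *+ (j == i)) * v j 0).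
rewrite e normcM mulrDl => h.
have -> : \sum_j A i j * normc (v j 0) = d * normc (v i 0) +
    \sum_j normc (toC (A i j - d *+ (j == i)) * v j 0).
  rewrite (bigD1 i) //= [in RHS](bigD1 i) //= eqxx addrA; congr (_ + _).
    rewrite normcM normc_real ger0_norm ?subr_ge0 //; rewrite /= mulr1n; ring.
  apply: eq_bigr => j ji; rewrite (negbTE ji) subr0 normcM normc_real.
  by rewrite ger0_norm.
by rewrite lerD2l.
Qed.

(** This is the equality case of the triangle inequality for [x = d + (x - d)]: as [d > 0], the
    number [x - d] must be real and nonnegative. *)
Lemma normc_shift_eq (x : C) : d + normc (x - toC d) <= normc x -> x = toC (normc x).
Proof.
case: x => a b /=; rewrite subr0.
set t := Num.sqrt ((a - d) ^+ 2 + _); set m := Num.sqrt (a ^+ 2 + _) => h.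
have t0 : 0 <= t by exact: sqrtr_ge0.
have m0 : 0 <= m by exact: sqrtr_ge0.
have t2 : t ^+ 2 = (a - d) ^+ 2 + b ^+ 2 by rewrite sqr_sqrtr // addr_ge0 // sqr_ge0.
have m2 : m ^+ 2 = a ^+ 2 + b ^+ 2 by rewrite sqr_sqrtr // addr_ge0 // sqr_ge0.
have h2 : (d + t) ^+ 2 <= m ^+ 2 by rewrite ler_sqr // nnegrE // addr_ge0 // ltW.
(* Expanding the squares in [h2] cancels [a ^+ 2 + b ^+ 2]. The result [t <= a - d] then leaves no
   room for [b]. *)
have h3 : d * (d + t - a) <= 0 by nra.
rewrite pmulr_rle0 // in h3.
have h4 : t ^+ 2 <= (a - d) ^+ 2 by rewrite ler_sqr // ?nnegrE; lra.
have b0 : b ^+ 2 = 0 by apply/eqP; rewrite eq_le sqr_ge0 andbT; lra.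
move/eqP: b0; rewrite sqrf_eq0 => /eqP b0.
have a0 : 0 <= a by have := d0; lra.
have am : a = m by rewrite /m b0 expr0n addr0 sqrtr_sqr ger0_norm.
by rewrite -am b0.
Qed.

(** [eigenvalueP] speaks of row vectors; transposition preserves the characteristic polynomial and
    turns them into columns. *)
Lemma col_eigenvectorP (x : C) :
  reflect (exists2 v : 'cV[C]_n.+1, AC *m v = x *: v & v != 0)
    (root (char_poly AC) x).
Proof.
have -> : char_poly AC = char_poly AC^T.
  rewrite /char_poly -det_tr /char_poly_mx linearB /= tr_scalar_mx.
  by rewrite !map_trmx.
rewrite -eigenvalue_root_char; apply: (iffP eigenvalueP) => -[v Av v0].
  exists v^T; last by rewrite trmx_eq0.
  by rewrite -[LHS]trmxK trmx_mul trmxK Av linearZ.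
exists v^T; last by rewrite trmx_eq0.
by rewrite -trmx_mul Av linearZ.
Qed.

(** The vector [u] stands in for a Perron eigenvector: it later forces the powers of [A] on the
    all-ones vector to grow at least like [p^k]. *)
Lemma dominant_root i0 : d <= A i0 i0 ->
  exists2 p : R, 0 < p &
  [/\ forall x, root (char_poly AC) x -> normc x <= p,
      forall x, root (char_poly AC) x -> x != toC p -> normc x < p &
      exists u : 'cV[R]_n.+1, [/\ forall i, 0 <= u i 0, exists i, 0 < u i 0 &
        forall i, p * u i 0 <= (A *m u) i 0]].
Proof.
move=> Ai0.
have [s Es] := closed_field_poly_normal (char_poly AC).
rewrite (monicP (char_poly_monic _)) scale1r in Es.
have rs x : root (char_poly AC) x = (x \in s) by rewrite Es root_prod_XsubC.
(* The basis vector at [i0] satisfies [A e >= d e]; hence the maximal modulus is positive. *)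
have [y ys dy] : exists2 y, y \in s & d <= normc y.
  apply: (exists_large_root (u := delta_mx i0 0) (i := i0) Es) => //.
  - by move=> i; rewrite mxE; case: (_ && _).
  - by rewrite mxE !eqxx.
  move=> i; rewrite -colE !mxE andbT; case: (eqVneq i i0) => [->|_].
    by rewrite mulr1.
  by rewrite mulr0.
have [x xs hx] := exists_max_modulus ys.
have x0 : 0 < normc x by apply: (lt_le_trans d0); apply: le_trans (hx _ ys).
(* Stated for every root of maximal modulus: the first half proves uniqueness, the second produces
   [u]. *)
have key w : w \in s -> normc w = normc x ->
    d + normc (w - toC d) <= normc w /\
    exists u : 'cV[R]_n.+1, [/\ forall i, 0 <= u i 0, exists i, 0 < u i 0 &
        forall i, normc w * u i 0 <= (A *m u) i 0].
  move=> ws wx; have w0 : w != 0 by rewrite -normc_eq0 wx gt_eqF.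
  have [v Av v0] : exists2 v : 'cV[C]_n.+1, AC *m v = w *: v & v != 0.
    by apply/col_eigenvectorP; rewrite rs.
  pose u := map_mx (@normc R) v.
  have u0 i : 0 <= u i 0 by rewrite mxE normc_ge0.
  have [i ui] : exists i, 0 < u i 0.
    apply/existsP; move: v0; apply: contraNT => /existsPn h.
    apply/eqP/matrixP => i j; rewrite [j]ord1 [RHS]mxE; apply/eqP.
    by move: (h i); rewrite lt_neqAle u0 andbT negbK mxE eq_sym normc_eq0.
  have hu j : (d + normc (w - toC d)) * u j 0 <= (A *m u) j 0.
    by rewrite [u j 0]mxE; apply: eigenvector_modulus.
  have dw : 0 < d + normc (w - toC d) by rewrite ltr_wpDr // normc_ge0.
  split; last first.
    exists u; split=> //; first by exists i.
    move=> j; apply: (le_trans _ (hu j)); rewrite ler_wpM2r //.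
    have := normcD (toC d) (w - toC d).
    by rewrite addrC subrK normc_real gtr0_norm.
  (* The sharpened inequality yields a root of modulus at least [d + |w - d|], and maximality bounds
     that modulus by [|w|]. *)
  have [z zs] := exists_large_root Es u0 ui dw hu.
  by move/le_trans; apply; rewrite wx; exact: hx.
exists (normc x) => //; split=> [w|w|].
- by rewrite rs; exact: hx.
- rewrite rs => ws; rewrite lt_neqAle hx // andbT; apply: contraNneq => wx.
  by rewrite -wx -(normc_shift_eq (key w ws wx).1).
by have [] := key x xs erefl.
Qed.

(** * Jordan chain at the dominant eigenvalue and asymptotics of the powers *)

Local Notation one := (const_mx 1 : 'cV[R]_n.+1).

(** The scaled chain [f j = p^-j N^j v] satisfies [A (f j) = p (f j + f (j+1))], so applying [A]
    acts on the coefficients by Pascal's rule. *)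
Lemma jordan_chain_expansion (N : 'M[R]_n.+1) (p : R) (v : 'cV[R]_n.+1) D k :
  A = p%:M + N -> p != 0 -> N ^+ D.+1 *m v = 0 ->
  A ^+ k *m v =
    p ^+ k *: \sum_(j < D.+1) 'C(k, j)%:R *: (p ^- j *: (N ^+ j *m v)).
Proof.
move=> EA p0 ND; pose f j := p ^- j *: (N ^+ j *m v).
have Af j : A *m f j = p *: (f j + f j.+1).
  rewrite EA mulmxDl mul_scalar_mx scalerDr; congr (_ + _).
  rewrite /f -scalemxAr mulmxA mulmxE -exprS scalerA [p ^+ j.+1]exprS invfM mulrA.
  by rewrite divff // mul1r.
have fD : f D.+1 = 0 by rewrite /f ND scaler0.
rewrite -[RHS]/(p ^+ k *: \sum_(j < D.+1) 'C(k, j)%:R *: f j).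
elim: k => [|k IHk].
  rewrite big_ord_recl big1 ?bin0 => [|j _]; last by rewrite bin0n scale0r.
  by rewrite /f !expr0 invr1 !scale1r mul1mx addr0.
rewrite exprS -mulmxE -mulmxA IHk -scalemxAr [p ^+ k.+1]exprSr -scalerA.
congr (_ *: _); rewrite mulmx_sumr.
under eq_bigr => j _ do
  rewrite -scalemxAr Af scalerA mulrC -scalerA scalerDr.
rewrite -scaler_sumr big_split /= [X in _ + X]big_ord_recr /= fD scaler0 addr0.
(* Both sides start with [f 0]; the remaining terms match one by one through [binS]. *)
rewrite big_ord_recl [in RHS]big_ord_recl /= !bin0 -addrA -big_split /=.
congr (_ *: (_ + _)); apply: eq_bigr => j _.
by rewrite binS natrD scalerDl.
Qed.


(** The factorisation [char_poly A = q (X - p)^m] is taken over the reals, so the splitting of the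
    all-ones vector is real; only the decay estimate on the [q] part passes to complex roots. *)
Lemma power_expansion i0 : d <= A i0 i0 ->
  exists p r K D (f : nat -> 'cV[R]_n.+1),
  [/\ 0 < r < p, forall x, root (char_poly AC) x -> normc x <= p,
      f D != 0, A *m f D = p *: f D &
      forall k i, `|(A ^+ k *m one) i 0 -
        p ^+ k * \sum_(j < D.+1) 'C(k, j)%:R * f j i 0| <= K * r ^+ k].
Proof.
move=> /dominant_root[p p0 [ple plt [u [u0 [i ui] hu]]]].
have [m [q qp Eq]] := multiplicity_XsubC (char_poly A) p.
rewrite monic_neq0 ?char_poly_monic //= in qp.
have [s Es] := closed_field_poly_normal (map_poly toC q).
have q0 : q != 0 by apply: contraNneq qp => ->; rewrite root0.
have lq : lead_coef (map_poly toC q) != 0.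
  by rewrite lead_coef_eq0 map_poly_eq0.
(* [q] does not vanish at [p], so its complex roots are roots of [char_poly] other than [p]. *)
have sp x : x \in s -> normc x < p.
  move=> xs; have qx : root (map_poly toC q) x.
    by rewrite Es rootZ // root_prod_XsubC.
  apply: plt.
    by rewrite -map_char_poly Eq rmorphM /= rootM qx.
  by apply: contraNneq qp => xp; rewrite -(fmorph_root toC) /= -xp.
have [r rp sr] := moduli_gap p0 sp.
have [r0 rltp] := andP rp.
have /Bezout_eq1_coprimepP[[a b] /= ab] : coprimep q (('X - p%:P) ^+ m).
  by rewrite coprimep_expr // coprimep_XsubC.
pose N := A - p%:M.
have EN : horner_mx A ('X - p%:P) = N.
  by rewrite rmorphB /= horner_mx_X horner_mx_C.
(* The Bezout identity splits the all-ones vector: [(A - p)^m] kills [vK] and [q(A)] kills [vR]. *)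
pose vK := horner_mx A (a * q) *m one.
pose vR := horner_mx A (b * ('X - p%:P) ^+ m) *m one.
have vKR : vK + vR = one by rewrite -mulmxDl -rmorphD ab rmorph1 mul1mx.
have NvK : N ^+ m *m vK = 0.
  rewrite -EN -rmorphXn mulmxA mulmxE -rmorphM /= mulrC -mulrA -Eq rmorphM /=.
  by rewrite Cayley_Hamilton mulr0 mul0mx.
have qvR : horner_mx A q *m vR = 0.
  rewrite mulmxA mulmxE -rmorphM /= mulrCA -Eq rmorphM /=.
  by rewrite Cayley_Hamilton mulr0 mul0mx.
have sR : horner_mx AC (\prod_(x <- s) ('X - x%:P)) *m map_mx toC vR = 0.
  apply: (scalerI lq); rewrite scaler0 scalemxAl -linearZ /= -Es.
  by rewrite -map_horner_mx -map_mxM qvR map_mx0.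
have [K K0 hK] := horner_ker_bound r0 sr sR.
have {}hK k j : `|(A ^+ k *m vR) j 0| <= K * r ^+ k.
  by have := hK k j; rewrite expmx_toC normc_real.
(* Otherwise the all-ones vector is [vR] and decays at rate [r < p], against the lower bound [p^k]
   supplied by [u]. *)
have vK0 : vK != 0.
  apply/eqP => vK0; rewrite vK0 add0r in vKR.
  (* This scaling puts [c *: u] below the all-ones vector in each coordinate. *)
  pose c := (\sum_j u j 0)^-1.
  have S0 : 0 < \sum_j u j 0.
    by rewrite (bigD1 i) //= ltr_pwDl // sumr_ge0.
  have c0 : 0 < c by rewrite invr_gt0.
  apply: (@expr_not_dominated (c * u i 0) K r p) => // [|k].
    by rewrite mulr_gt0.
  apply: (le_trans _ (hK k i)); apply: le_trans (ler_norm _); rewrite vKR.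
  apply: (le_trans _ (expmx_le (u := c *: u) k i _)); last first.
    move=> j; rewrite !mxE mulrC ler_pdivrMr // mul1r (bigD1 j) //= lerDl.
    by rewrite sumr_ge0.
  rewrite -scalemxAr mxE -mulrA ler_wpM2l ?(ltW c0) // mulrC.
  by apply: expmx_supereigen => //; exact: ltW.
have exm : exists m, N ^+ m *m vK == 0 by exists m; apply/eqP.
(* The least exponent killing [vK] is positive since [vK != 0]. Calling it [D + 1] makes [N^D vK]
   nonzero and an eigenvector for [p]. *)
case: (ex_minnP exm) => [[|D]] /eqP ND minD.
  by rewrite expr0 mul1mx in ND; rewrite ND eqxx in vK0.
have EA : A = p%:M + N by rewrite addrC subrK.
exists p, r, K, D, (fun j => p ^- j *: (N ^+ j *m vK)); split=> //.
- rewrite scaler_eq0 invr_eq0 expf_eq0 (gt_eqF p0) andbF /=.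
  by apply/negP => /minD; rewrite ltnn.
- rewrite -scalemxAr {1}EA mulmxDl mul_scalar_mx.
  by rewrite [X in _ + X]mulmxA mulmxE -exprS ND addr0 scalerA mulrC -scalerA.
move=> k j; apply: le_trans (hK k j); rewrite le_eqVlt; apply/orP; left.
apply/eqP; congr (`|_|); rewrite -vKR mulmxDr.
rewrite (jordan_chain_expansion k EA (lt0r_neq0 p0) ND) mxE addrAC.
rewrite [X in X - _]mxE summxE.
under [X in _ * X - _]eq_bigr => l _ do rewrite mxE.
by rewrite subrr add0r.
Qed.

(** The factor [k - D] encodes convergence at rate [1 / k] as a plain inequality, without a notion
    of limit. *)
Theorem power_asymptotics i0 : d <= A i0 i0 ->
  exists p (z : 'cV[R]_n.+1) K D,
  [/\ 0 < p, forall x, root (char_poly AC) x -> normc x <= p,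
      z != 0, A *m z = p *: z &
      forall k i, (D + D <= k)%N ->
      `|(A ^+ k *m one) i 0 / (p ^+ k * 'C(k, D)%:R) - z i 0| * (k - D)%:R <= K].
Proof.
move=> /power_expansion[p [r [K [D [f [rp ple fD AfD hf]]]]]].
have [r0 rltp] := andP rp; have p0 := lt_trans r0 rltp.
have [L L0 hL] := expr_ratio_bound rp.
(* The first summand bounds the lower chain terms, summed over [i] to be uniform in the coordinate;
   the second bounds the remainder [E]. *)
exists p, (f D), (D%:R * \sum_i \sum_(j < D) `|f j i 0| + `|K| * L), D.
split=> // k i Dk.
have Dk' : (D <= k)%N by apply: leq_trans Dk; exact: leq_addr.
have b0 : 0 < 'C(k, D)%:R :> R by rewrite ltr0n bin_gt0.
have b1 : 1 <= 'C(k, D)%:R :> R by rewrite ler1n bin_gt0.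
set g := p ^+ k * _; have pk : 0 < p ^+ k by rewrite exprn_gt0.
have g0 : 0 < g by rewrite mulr_gt0.
pose E := (A ^+ k *m one) i 0 - p ^+ k * \sum_(j < D.+1) 'C(k, j)%:R * f j i 0.
(* The top term of the chain, divided by [g], is exactly [f D] and cancels. *)
have -> : (A ^+ k *m one) i 0 / g - f D i 0 =
    (\sum_(j < D) 'C(k, j)%:R * f j i 0) / 'C(k, D)%:R + E / g.
  have -> : (A ^+ k *m one) i 0 =
     E + p ^+ k * \sum_(j < D.+1) 'C(k, j)%:R * f j i 0 by rewrite /E subrK.
  rewrite big_ord_recr /= /g; field.
  by rewrite !gt_eqF.
apply: (le_trans (ler_wpM2r _ (ler_normD _ _))); first by [].
rewrite mulrDl; apply: lerD; last first.
  rewrite normrM normfV (gtr0_norm g0).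
  have h : `|E| / g <= `|K| * (r / p) ^+ k.
    rewrite ler_pdivrMr // expr_div_n mulrA /g mulrA divfK ?gt_eqF //.
    apply: (le_trans (hf k i)); apply: (@le_trans _ _ (`|K| * r ^+ k)).
      by rewrite ler_wpM2r ?exprn_ge0 ?(ltW r0) // ler_norm.
    by rewrite ler_peMr // mulr_ge0 // exprn_ge0 // ltW.
  apply: (le_trans (ler_wpM2r _ h)); first by [].
  rewrite -mulrA ler_wpM2l //; apply: le_trans (hL k).
  rewrite ler_wpM2l // ?ler_nat ?leq_subr // exprn_ge0 // divr_ge0 // ltW //.
rewrite normrM normfV (gtr0_norm b0) mulrAC ler_pdivrMr // mulr_sumr mulr_suml.
apply: (@le_trans _ _ (D%:R * (\sum_(j < D) `|f j i 0|) * 'C(k, D)%:R)); last first.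
  rewrite -mulr_suml -mulr_sumr ler_wpM2r ?(ltW b0) // ler_wpM2l //.
  rewrite (bigD1 i) //= lerDl; apply: sumr_ge0 => l _.
  by apply: sumr_ge0.
apply: (le_trans (ler_wpM2r _ (ler_norm_sum _ _ _))); first by [].
rewrite mulr_sumr !mulr_suml; apply: ler_sum => j _.
rewrite normrM normr_nat mulrAC -natrM.
rewrite [X in _ <= X]mulrAC -natrM ler_wpM2r //.
by rewrite ler_nat bin_ratio_le.
Qed.

End NonNegative.
End Spectral.

(** * Transfer to function-encoded matrices and limits over the standard reals *)

Section Bridge.
Import Rstruct.
Local Notation R := Rdefinitions.R.

Lemma sumRE (n : nat) (f : nat -> R) : sumR n f = \sum_(i < n) f i.
Proof. by elim: n => [|n IHn] /=; rewrite ?big_ord0 // big_ord_recr /= IHn. Qed.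

Lemma sum_complex (I : finType) (a u v : I -> R) :
  \sum_i (a i)%:C%C * (u i +i* v i)%C =
    ((\sum_i a i * u i) +i* (\sum_i a i * v i))%C.
Proof.
apply: (big_ind3 (fun x y z => x = (y +i* z)%C)) => // [|i _].
  by move=> x1 x2 x3 y1 y2 y3 -> ->.
by apply/eqP; rewrite eq_complex /= !mul0r subr0 addr0 !eqxx.
Qed.

Variables (n : nat) (A : nat -> nat -> R).
Let M : 'M[R]_n.+1 := \matrix_(i, j) A i j.

Lemma matvecE (v : nat -> R) (i : 'I_n.+1) :
  matvec n.+1 A v i = (M *m \col_j v j) i 0.
Proof. by rewrite /matvec sumRE mxE; apply: eq_bigr => j _; rewrite !mxE. Qed.

Lemma matpowvecE (v : nat -> R) k (i : 'I_n.+1) :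
  matpowvec n.+1 A k v i = (M ^+ k *m \col_j v j) i 0.
Proof.
elim: k i => [|k IHk] i; first by rewrite expr0 mul1mx mxE.
rewrite /= matvecE exprS -mulmxE -mulmxA; congr ((_ *m _) i 0).
by apply/matrixP => j l; rewrite [l]ord1 -IHk mxE.
Qed.

Lemma Un_cv_of_bound (u : nat -> R) (l K : R) (D : nat) :
  (forall k, (D + D <= k)%N -> `|u k - l| * (k - D)%:R <= K) -> Un_cv u l.
Proof.
move=> h e /RltP e0; pose b := Num.bound (`|K| / e).
exists (D + D + b.+1)%N => k /ssrnat.leP hk.
have Dk : (D + D <= k)%N by apply: leq_trans hk; exact: leq_addr.
have hb : `|K| < b%:R * e.
  by rewrite -ltr_pdivrMr //; apply: archi_boundP; rewrite divr_ge0 // ltW.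
have bk : (b.+1 <= k - D)%N.
  rewrite leq_subRL ?(leq_trans (leq_addr D D)) //.
  by apply: leq_trans hk; rewrite leq_add2r leq_addr.
apply/RltP; rewrite RdistE -(@ltr_pM2r _ (k - D)%:R); last first.
  by rewrite ltr0n (leq_trans _ bk).
apply: (le_lt_trans (h k Dk)); apply: (le_lt_trans (ler_norm K)).
apply: (lt_le_trans hb); rewrite mulrC ler_wpM2l ?(ltW e0) // ler_nat.
exact: ltnW.
Qed.

Lemma power_limit (d : R) : 0 < d ->
  (forall i j, (i < n.+1)%N -> (j < n.+1)%N -> 0 <= A i j) ->
  (forall i, (i < n.+1)%N -> d <= A i i \/ forall j, (j < n.+1)%N -> A i j = 0) ->
  (exists2 i, (i < n.+1)%N & d <= A i i) ->
  exists p (w g : nat -> R) N,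
  [/\ 0 < p, forall k, (N <= k)%N -> 0 < g k,
      forall i, (i < n.+1)%N ->
        Un_cv (fun k => matpowvec n.+1 A k ones i / g k) (w i),
      exists2 i, (i < n.+1)%N & w i <> 0 &
      (forall i, (i < n.+1)%N -> matvec n.+1 A w i = p * w i) /\
      (forall a b, is_eigenvalueC n.+1 A a b -> sqrt (a * a + b * b) <= p)].
Proof.
move=> d0 A0 Ad [i0 i0n di0].
have M0 i j : 0 <= M i j by rewrite mxE A0.
have Md i : d <= M i i \/ forall j, M i j = 0.
  rewrite mxE; case: (Ad i (ltn_ord i)) => h; [by left|right=> j].
  by rewrite mxE h.
have Mi0 : d <= M (Ordinal i0n) (Ordinal i0n) by rewrite mxE.
have [p [z [K [D [p0 ple z0 Mz hz]]]]] := power_asymptotics M0 d0 Md Mi0.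
pose w i := z (inord i) 0.
have wE : \col_(j < n.+1) w j = z.
  by apply/matrixP => i j; rewrite [j]ord1 mxE /w inord_val.
(* The scale vanishes for [k < D], hence a threshold; [D + D] is the range of the error bound. *)
exists p, w, (fun k => p ^+ k * 'C(k, D)%:R), (D + D)%N; split=> //.
- move=> k Dk; rewrite mulr_gt0 ?exprn_gt0 // ltr0n bin_gt0.
  by apply: leq_trans Dk; exact: leq_addr.
- move=> l ll; apply: (@Un_cv_of_bound _ _ K D) => k Dk.
  have := hz k (Ordinal ll) Dk.
  rewrite -[l]/(nat_of_ord (Ordinal ll)) matpowvecE /w inord_val.
  suff -> : \col_(j < n.+1) ones j = const_mx 1 by [].
  by apply/matrixP => ? ?; rewrite !mxE.
- have [i zi] : exists i, z i 0 != 0.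
    apply/existsP; move: z0; apply: contraNT => /existsPn h.
    apply/eqP/matrixP => i j; rewrite [j]ord1 mxE; apply/eqP.
    by move: (h i); rewrite negbK.
  by exists i => //; rewrite /w inord_val; apply/eqP.
split=> [l ll|a b [u [v [[i [ii uv]] huv]]]].
  rewrite -[l]/(nat_of_ord (Ordinal ll)) matvecE wE Mz mxE.
  by rewrite /w inord_val.
pose c : 'cV[R[i]]_n.+1 := \col_j (u j +i* v j)%C.
have := ple (a +i* b)%C; rewrite RsqrtE /normc !expr2; apply.
apply/col_eigenvectorP; exists c.
  apply/matrixP => j l; rewrite [l]ord1.
  have [hu hv] := huv j (elimT ssrnat.ltP (ltn_ord j)).
  rewrite !matvecE !mxE in hu hv; rewrite !mxE.
  under eq_bigr => k _ do rewrite [in X in X * _]mxE [c _ _]mxE.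
  rewrite sum_complex; apply/eqP; rewrite eq_complex /=.
  rewrite -RminusE -RplusE -!RmultE (Rplus_comm (Rmult a _)) -hu -hv.
  by apply/andP; split; apply/eqP; apply: eq_bigr => k _; rewrite !mxE.
apply/eqP => /matrixP /(_ (Ordinal (introT ssrnat.ltP ii)) 0); rewrite !mxE /=.
by case=> u0 v0; case: uv.
Qed.

End Bridge.

Local Open Scope R_scope.

(** Interface in standard-library notation for use outside the module. MathComp square matrices here
    have size [n.+1]; the required diagonal index rules out dimension zero. *)
Lemma power_limit_R (m : nat) (A : nat -> nat -> Rdefinitions.R) d :
  0 < d ->
  (forall i j, (i < m)%coq_nat -> (j < m)%coq_nat -> 0 <= A i j) ->
  (forall i, (i < m)%coq_nat ->
     d <= A i i \/ forall j, (j < m)%coq_nat -> A i j = 0) ->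
  (exists i, (i < m)%coq_nat /\ d <= A i i) ->
  exists p (w g : nat -> Rdefinitions.R) N,
    0 < p /\ (forall k, (N <= k)%coq_nat -> 0 < g k) /\
    (forall i, (i < m)%coq_nat ->
       Un_cv (fun k => matpowvec m A k ones i / g k) (w i)) /\
    (exists i, (i < m)%coq_nat /\ w i <> 0) /\
    (forall i, (i < m)%coq_nat -> matvec m A w i = p * w i) /\
    (forall a b, is_eigenvalueC m A a b -> sqrt (a * a + b * b) <= p).
Proof.
case: m => [|n] d0 A0 Ad [i [/ssrnat.ltP im di]] //.
have [||||p [w [g [N [p0 g0 cv [j jm wj] [Aw ev]]]]]] := @power_limit n A d.
- exact/Rstruct.RltP.
- by move=> k l /ssrnat.ltP kn /ssrnat.ltP ln; apply/Rstruct.RleP/A0.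
- move=> k /ssrnat.ltP kn; case: (Ad k kn) => h; first by left; apply/Rstruct.RleP.
  by right=> l /ssrnat.ltP; exact: h.
- by exists i => //; apply/Rstruct.RleP.
exists p, w, g, N; split; first exact/Rstruct.RltP.
split; first by move=> k /ssrnat.leP /g0 /Rstruct.RltP.
split; first by move=> k /ssrnat.ltP /cv h; exact: h.
split; first by exists j; split=> //; apply/ssrnat.ltP.
split; first by move=> k /ssrnat.ltP /Aw.
by move=> a b /ev /Rstruct.RleP.
Qed.

End Spectral.

(** * Finite sums, limits and normalised power iteration *)

Lemma sumR_ext (d : nat) (f g : nat -> R) :
  (forall i, (i < d)%nat -> f i = g i) -> sumR d f = sumR d g.
Proof.
  induction d as [|d IH]; simpl; intros H; [reflexivity|].
  rewrite IH by (intros; apply H; lia). now rewrite H by lia.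
Qed.

Lemma sumR_nonneg (d : nat) (f : nat -> R) :
  (forall i, (i < d)%nat -> 0 <= f i) -> 0 <= sumR d f.
Proof.
  induction d as [|d IH]; simpl; intros H; [lra|].
  assert (0 <= sumR d f) by (apply IH; intros; apply H; lia).
  assert (0 <= f d) by (apply H; lia). lra.
Qed.

Lemma sumR_term_le (d : nat) (f : nat -> R) (i : nat) :
  (forall i, (i < d)%nat -> 0 <= f i) -> (i < d)%nat -> f i <= sumR d f.
Proof.
  induction d as [|d IH]; simpl; intros H Hi; [lia|].
  assert (0 <= f d) by (apply H; lia).
  assert (0 <= sumR d f) by (apply sumR_nonneg; intros; apply H; lia).
  destruct (Nat.eq_dec i d) as [->|Hne]; [lra|].
  assert (f i <= sumR d f) by (apply IH; [intros; apply H|]; lia). lra.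
Qed.

Lemma sumR_div (d : nat) (f : nat -> R) (c : R) :
  sumR d (fun i => f i / c) = sumR d f / c.
Proof. induction d as [|d IH]; simpl; [|rewrite IH]; unfold Rdiv; ring. Qed.

Lemma sumR_cv (d : nat) (u : nat -> nat -> R) (l : nat -> R) :
  (forall i, (i < d)%nat -> Un_cv (fun k => u k i) (l i)) ->
  Un_cv (fun k => sumR d (u k)) (sumR d l).
Proof.
  induction d as [|d IH]; simpl; intros H.
  - intros e He; exists 0%nat; intros; rewrite Rdist_eq; lra.
  - apply CV_plus; [apply IH; intros; apply H|apply H]; lia.
Qed.

Lemma Un_cv_nonneg (u : nat -> R) (l : R) :
  (forall k, 0 <= u k) -> Un_cv u l -> 0 <= l.
Proof.
  intros Hu Hl. apply Rnot_lt_le; intros Hneg.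
  destruct (Hl (- l)) as [N HN]; [lra|].
  specialize (HN N (le_n _)). specialize (Hu N).
  unfold Rdist in HN. apply Rabs_def2 in HN. lra.
Qed.

Lemma Un_cv_eventually (u v : nat -> R) (l : R) (N : nat) :
  (forall k, (N <= k)%nat -> u k = v k) -> Un_cv u l -> Un_cv v l.
Proof.
  intros Huv Hu e He. destruct (Hu e He) as [N' HN].
  exists (N + N')%nat. intros k Hk. rewrite <- Huv by lia. apply HN; lia.
Qed.

Lemma matvec_nonneg (d : nat) (A : nat -> nat -> R) (v : nat -> R) (i : nat) :
  (forall j, (j < d)%nat -> 0 <= A i j) ->
  (forall j, (j < d)%nat -> 0 <= v j) -> 0 <= matvec d A v i.
Proof. intros HA Hv. apply sumR_nonneg; intros; apply Rmult_le_pos; auto. Qed.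

Lemma matpowvec_nonneg (d : nat) (A : nat -> nat -> R) (v : nat -> R) (k : nat) :
  (forall i j, (i < d)%nat -> (j < d)%nat -> 0 <= A i j) ->
  (forall i, (i < d)%nat -> 0 <= v i) ->
  forall i, (i < d)%nat -> 0 <= matpowvec d A k v i.
Proof.
  intros HA Hv. induction k as [|k IH]; simpl; intros i Hi; [auto|].
  apply matvec_nonneg; auto.
Qed.

(** Normalisation ignores positive scaling, so [A^k 1] may be replaced by [A^k 1 / g k], which tends
    to a nonzero [w]. Continuity of the 1-norm and of inversion at a nonzero point gives the limit
    [w / S]. *)
Theorem normalized_power_iteration (d : nat) (A : nat -> nat -> R) (delta : R) :
  0 < delta ->
  (forall i j, (i < d)%nat -> (j < d)%nat -> 0 <= A i j) ->
  (forall i, (i < d)%nat ->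
     delta <= A i i \/ forall j, (j < d)%nat -> A i j = 0) ->
  (exists i, (i < d)%nat /\ delta <= A i i) ->
  exists z : nat -> R,
    (forall i, (i < d)%nat ->
       Un_cv (fun k => normalize1 d (matpowvec d A k ones) i) (z i)) /\
    principal_eigenvector d A z /\
    (forall i, (i < d)%nat -> 0 <= z i) /\ sumR d z = 1.
Proof.
  intros Hdelta HA Hdiag Hex.
  destruct (@Spectral.power_limit_R d A delta Hdelta HA Hdiag Hex)
    as (p & w & g & N & Hp & Hg & Hcv & (i0 & Hi0 & Hw0) & HAw & Hev).
  set (a := fun k => matpowvec d A k ones) in *.
  assert (Ha : forall k i, (i < d)%nat -> 0 <= a k i).
  { intros k. apply matpowvec_nonneg; [exact HA|].
    intros; unfold ones; lra. }
  set (S := sumR d (fun i => Rabs (w i))).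
  assert (HS : 0 < S).
  { apply Rlt_le_trans with (Rabs (w i0)); [now apply Rabs_pos_lt|].
    apply (sumR_term_le d (fun i => Rabs (w i))); [|assumption].
    intros; apply Rabs_pos. }
  assert (Hnorm : forall i, (i < d)%nat ->
    Un_cv (fun k => normalize1 d (a k) i) (w i / S)).
  { intros i Hi.
    apply (Un_cv_eventually
      (fun k => a k i / g k * / sumR d (fun j => Rabs (a k j / g k))) _ _ N).
    - intros k Hk. specialize (Hg k Hk). unfold normalize1.
      rewrite (sumR_ext d (fun j => Rabs (a k j / g k))
                 (fun j => Rabs (a k j) / g k)).
      + rewrite sumR_div. unfold Rdiv.
        rewrite Rinv_mult, Rinv_inv, <- Rmult_assoc, (Rmult_assoc (a k i)).
        rewrite (Rmult_comm (/ g k)), <- Rmult_assoc, Rmult_assoc.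
        rewrite Rinv_l by lra. apply Rmult_1_r.
      + intros j _. unfold Rdiv. rewrite Rabs_mult, (Rabs_pos_eq (/ g k)).
        * reflexivity.
        * left; now apply Rinv_0_lt_compat.
    - apply CV_mult; [now apply Hcv|].
      apply (continuity_seq Rinv).
      + apply (continuity_pt_inv (fun x => x)); [|fold S; lra].
        apply derivable_continuous_pt, derivable_pt_id.
      + apply sumR_cv. intros j Hj. apply cv_cvabs. now apply Hcv. }
  exists (fun i => w i / S).
  assert (Hz : forall i, (i < d)%nat -> 0 <= w i / S).
  { intros i Hi. apply Un_cv_nonneg with (fun k => normalize1 d (a k) i);
      [|now apply Hnorm].
    intros k. unfold normalize1, Rdiv. apply Rmult_le_pos; [now apply Ha|].
    assert (H : 0 <= sumR d (fun j => Rabs (a k j)))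
      by (apply sumR_nonneg; intros; apply Rabs_pos).
    (* A zero norm is harmless here, since [/ 0] is [0] by convention. *)
    destruct H as [H| <-]; [left; now apply Rinv_0_lt_compat|].
    rewrite Rinv_0; lra. }
  (* Nonnegativity of the limit turns the 1-norm [S] into the plain sum of [w], so the limit sums to
     1. *)
  assert (Hw : forall i, (i < d)%nat -> Rabs (w i) = w i).
  { intros i Hi. apply Rabs_pos_eq.
    replace (w i) with (w i / S * S) by (field; lra).
    apply Rmult_le_pos; [now apply Hz|lra]. }
  repeat split.
  - exact Hnorm.
  - exists p. repeat split.
    + exists i0. split; [assumption|]. intros H. apply Hw0.
      replace (w i0) with (w i0 / S * S) by (field; lra). rewrite H; ring.
    + intros i Hi. unfold matvec.
      rewrite (sumR_ext d _ (fun j => A i j * w j / S)).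
      * rewrite sumR_div. unfold matvec in HAw. rewrite HAw by assumption.
        unfold Rdiv; ring.
      * intros; unfold Rdiv; ring.
    + intros x y H. rewrite Rabs_pos_eq by lra. now apply Hev.
  - exact Hz.
  - rewrite sumR_div, <- (sumR_ext _ _ w Hw). fold S. apply Rinv_r; lra.
Qed.

(** * Sign and diagonal of the matrices [P] and [Q] *)

Lemma b2R_nonneg (b : bool) : 0 <= b2R b.
Proof. destruct b; simpl; lra. Qed.

Lemma ICTmat_nonneg Cb j k : 0 <= ICTmat Cb j k.
Proof.
  unfold ICTmat. pose proof (b2R_nonneg (Cb k j)).
  destruct (Nat.eqb j k); lra.
Qed.

Lemma ICTmat_diag Cb j : 1 <= ICTmat Cb j j.
Proof.
  unfold ICTmat. rewrite Nat.eqb_refl. pose proof (b2R_nonneg (Cb j j)). lra.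
Qed.

Lemma Wmat_nonneg m Mb i j : 0 <= Wmat m Mb i j.
Proof.
  unfold Wmat, Rdiv. apply Rmult_le_pos; [apply b2R_nonneg|].
  assert (H : 0 <= sumR m (fun l => b2R (Mb l j)))
    by (apply sumR_nonneg; intros; apply b2R_nonneg).
  (* A column without authors has weight [0] because [/ 0 = 0]. *)
  destruct H as [H| <-]; [left; now apply Rinv_0_lt_compat|].
  rewrite Rinv_0; lra.
Qed.

Lemma sumR_b2R_le m (f : nat -> bool) : sumR m (fun l => b2R (f l)) <= INR m.
Proof.
  induction m as [|m IH]; [simpl; lra|].
  rewrite S_INR; cbn [sumR]. destruct (f m); simpl; lra.
Qed.

(** A paper has at most [m] authors, so each of them receives a share of at least [1 / m]. *)
Lemma Wmat_author m Mb i j :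
  (i < m)%nat -> Mb i j = true -> / INR m <= Wmat m Mb i j.
Proof.
  intros Hi Hb. unfold Wmat. rewrite Hb. unfold Rdiv. simpl.
  rewrite Rmult_1_l. apply Rinv_le_contravar; [|apply sumR_b2R_le].
  apply Rlt_le_trans with (b2R (Mb i j)); [rewrite Hb; simpl; lra|].
  apply (sumR_term_le m (fun l => b2R (Mb l j))); [|assumption].
  intros; apply b2R_nonneg.
Qed.

Lemma matmul_nonneg d A B i k :
  (forall j, 0 <= A i j) -> (forall j, 0 <= B j k) -> 0 <= matmul d A B i k.
Proof. intros HA HB. apply sumR_nonneg; intros; now apply Rmult_le_pos. Qed.

Lemma matmul_term_le d A B i j k :
  (j < d)%nat -> (forall j, 0 <= A i j) -> (forall j, 0 <= B j k) ->
  A i j * B j k <= matmul d A B i k.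
Proof.
  intros Hj HA HB. apply (sumR_term_le d (fun j => A i j * B j k));
    [intros; now apply Rmult_le_pos|assumption].
Qed.

Lemma Pmat_nonneg m n Mb Cb i k : 0 <= Pmat m n Mb Cb i k.
Proof.
  apply matmul_nonneg; intros j; [|apply b2R_nonneg].
  apply matmul_nonneg; intros l; [apply Wmat_nonneg|apply ICTmat_nonneg].
Qed.

Lemma Qmat_nonneg m n Mb Cb i k : 0 <= Qmat m n Mb Cb i k.
Proof.
  apply matmul_nonneg; intros j; [|apply Wmat_nonneg].
  apply matmul_nonneg; intros l; [apply ICTmat_nonneg|apply b2R_nonneg].
Qed.

(** The single path from author [i] to paper [j], along the identity in [I + C^T], and back to [i]
    already contributes [1 / m]. *)
Lemma Pmat_diag m n Mb Cb i j :
  (i < m)%nat -> (j < n)%nat -> Mb i j = true -> / INR m <= Pmat m n Mb Cb i i.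
Proof.
  intros Hi Hj Hb.
  pose proof (Wmat_author m Mb i j Hi Hb) as HW.
  pose proof (ICTmat_diag Cb j) as HC.
  assert (0 < / INR m) by (apply Rinv_0_lt_compat, lt_0_INR; lia).
  apply Rle_trans with (matmul n (Wmat m Mb) (ICTmat Cb) i j * MTmat Mb j i).
  - unfold MTmat; rewrite Hb; simpl; rewrite Rmult_1_r.
    apply Rle_trans with (Wmat m Mb i j * ICTmat Cb j j); [nra|].
    apply matmul_term_le; [assumption|intros; apply Wmat_nonneg|
      intros; apply ICTmat_nonneg].
  - apply matmul_term_le; [assumption| |intros; apply b2R_nonneg].
    intros l; apply matmul_nonneg; intros;
      [apply Wmat_nonneg|apply ICTmat_nonneg].
Qed.

(** Authors without papers provide the zero-row alternative of the diagonal condition. *)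
Lemma Pmat_zero_row m n Mb Cb i k :
  (forall j, (j < n)%nat -> Mb i j = false) -> Pmat m n Mb Cb i k = 0.
Proof.
  intros Hb.
  assert (sumR0 : forall d f, (forall j, (j < d)%nat -> f j = 0) -> sumR d f = 0).
  { intros d f; induction d as [|d IH]; simpl; intros H; [reflexivity|].
    rewrite IH by (intros; apply H; lia). rewrite H by lia. lra. }
  apply sumR0; intros j Hj.
  replace (matmul n (Wmat m Mb) (ICTmat Cb) i j) with 0; [ring|symmetry].
  apply sumR0; intros l Hl. unfold Wmat. rewrite Hb by assumption.
  unfold Rdiv; simpl; ring.
Qed.

Lemma Qmat_diag m n Mb Cb i j :
  (i < m)%nat -> (j < n)%nat -> Mb i j = true -> / INR m <= Qmat m n Mb Cb j j.
Proof.
  intros Hi Hj Hb.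
  pose proof (Wmat_author m Mb i j Hi Hb) as HW.
  pose proof (ICTmat_diag Cb j) as HC.
  assert (0 < / INR m) by (apply Rinv_0_lt_compat, lt_0_INR; lia).
  assert (H1 : 1 <= matmul n (ICTmat Cb) (MTmat Mb) j i).
  { apply Rle_trans with (ICTmat Cb j j * MTmat Mb j i).
    - unfold MTmat; rewrite Hb; simpl; lra.
    - apply matmul_term_le; [assumption|intros; apply ICTmat_nonneg|
        intros; apply b2R_nonneg]. }
  apply Rle_trans with (matmul n (ICTmat Cb) (MTmat Mb) j i * Wmat m Mb i j);
    [nra|].
  apply matmul_term_le; [assumption| |intros; apply Wmat_nonneg].
  intros l; apply matmul_nonneg; intros; [apply ICTmat_nonneg|apply b2R_nonneg].
Qed.

Theorem theorem1 (m n : nat) (Mb Cb : nat -> nat -> bool)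
  (Hn : (0 < n)%nat)
  (Hauth : forall j, (j < n)%nat -> exists i, (i < m)%nat /\ Mb i j = true)
  (Hacyc : acyclic n Cb) :
  exists xstar ystar : nat -> R,
    (forall i, (i < m)%nat -> Un_cv (fun k => xseq m n Mb Cb k i) (xstar i)) /\
    (forall j, (j < n)%nat -> Un_cv (fun k => yseq m n Mb Cb k j) (ystar j)) /\
    principal_eigenvector m (Pmat m n Mb Cb) xstar /\
    principal_eigenvector n (Qmat m n Mb Cb) ystar /\
    (forall i, (i < m)%nat -> 0 <= xstar i) /\
    (forall j, (j < n)%nat -> 0 <= ystar j) /\
    sumR m xstar = 1 /\ sumR n ystar = 1.
Proof.
  (* An author of paper [0] shows [m > 0] and gives [P] a positive diagonal entry. *)
  destruct (Hauth 0%nat Hn) as (i0 & Hi0 & Hb0).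
  assert (Hm : 0 < / INR m) by (apply Rinv_0_lt_compat, lt_0_INR; lia).
  destruct (normalized_power_iteration m (Pmat m n Mb Cb) (/ INR m) Hm)
    as (x & Hx1 & Hx2 & Hx3 & Hx4).
  { intros; apply Pmat_nonneg. }
  { intros i Hi.
    destruct (classic (exists j, (j < n)%nat /\ Mb i j = true))
      as [(j & Hj & Hb)|Hno].
    - left. now apply Pmat_diag with j.
    - right; intros k _. apply Pmat_zero_row. intros j Hj.
      apply Bool.not_true_is_false. intros Hb. apply Hno. now exists j. }
  { exists i0. split; [assumption|]. now apply Pmat_diag with 0%nat. }
  (* Each paper has an author, so every diagonal entry of [Q] is at least [1 / m]. *)
  assert (HQ : forall j, (j < n)%nat -> / INR m <= Qmat m n Mb Cb j j).
  { intros j Hj. destruct (Hauth j Hj) as (i & Hi & Hb).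
    now apply Qmat_diag with i. }
  destruct (normalized_power_iteration n (Qmat m n Mb Cb) (/ INR m) Hm)
    as (y & Hy1 & Hy2 & Hy3 & Hy4).
  { intros; apply Qmat_nonneg. }
  { intros j Hj. left. now apply HQ. }
  { exists 0%nat. split; [assumption|]. now apply HQ. }
  exists x, y. repeat split; assumption.
Qed.
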